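(* Let $f:\mathbb{R}^n\to\mathbb{R}\cup\{\infty\}$ be convex and differentiable and let $X\subseteq\mathrm{dom}(f)$ be a compact convex set. Let $\mathfrak{R}:=\mathfrak{r}^2/2$ where $\mathfrak{r}:X\times X\to\mathbb{R}_+$ is the radial distance \[ \mathfrak{r}(y,x):=\inf\{\rho>0:\ y-x=\rho\cdot(u-x)\text{ for some }u\in X\}. \] Suppose $f^\star:=\min_{x\in X}f(x)$ is finite, $X^\star:=\{x\in X:f(x)=f^\star\}\neq\emptyset$, and the map $x\mapsto\bar x:=\mathrm{argmin}_{y\in X^\star}\mathfrak{R}(y,x)$ is well defined for all $x\in X$. Suppose $L:=L_{f,X,\mathfrak{R}}<\infty$ and $\mu:=\max\{\mu^\star_{f,X,\mathfrak{R}},\ \mu^\sharp_{f,X,\mathfrak{R}}/4\}>0$. Let $x_0\in X$ and let $x_k$, $k=0,1,\dots$, be generated by the Frank-Wolfe algorithm: for $k=0,1,\dots$, \[ u_k:=\mathrm{argmin}_{y\in X}\langle\nabla f(x_k),y\rangle,\qquad x_{k+1}=x_k+\alpha_k(u_k-x_k), \] where each stepsize is chosen via \[ \alpha_k=\mathrm{argmin}_{\alpha\in[0,1]}\left\{f(x_k)+\alpha\langle\nabla f(x_k),u_k-x_k\rangle+\frac{L\alpha^2}{2}\right\}. \] Then the iterates satisfy \[ f(x_k)-f^\star\le\left(1-\frac{\mu}{L}\right)^k(f(x_0)-f^\star). \]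
   Context: Bregman distance: $D_f(y,x)=f(y)-f(x)-\langle\nabla f(x),y-x\rangle$. In the algorithm, $u_k$ is the minimizer returned by a linear oracle for $X$. Relative smoothness, quasi-strong convexity, and functional growth constants: \[ L_{f,X,\mathfrak{R}}:=\inf\{L>0:\ D_f(y,x)\le L\,\mathfrak{R}(y,x)\ \forall x,y\in X\}, \] \[ \mu^\star_{f,X,\mathfrak{R}}:=\sup\{\mu\ge0:\ D_f(\bar x,x)\ge\mu\,\mathfrak{R}(\bar x,x)\ \forall x\in X\}, \] \[ \mu^\sharp_{f,X,\mathfrak{R}}:=\sup\{\mu\ge0:\ f(x)-f^\star\ge\mu\,\mathfrak{R}(\bar x,x)\ \forall x\in X\}. \] *)

(* Defs.v *)
From HB Require Import structures.
From mathcomp Require Import all_boot all_order all_algebra.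
From mathcomp Require Import interval_inference.
From mathcomp Require Import all_classical all_reals all_analysis.

Set Implicit Arguments.
Unset Strict Implicit.
Unset Printing Implicit Defensive.

Import Order.TTheory GRing.Theory Num.Theory.
Import numFieldNormedType.Exports.

Local Open Scope classical_set_scope.
Local Open Scope ring_scope.

Definition argmin_set {d : Order.disp_t} {T : Type} {U : porderType d}
    (A : set T) (h : T -> U) : set T :=
  [set x | A x /\ forall y, A y -> (h x <= h y)%O].

Section ExtendedFunctions.
Context {R : realType} {n : nat}.
Local Notation V := 'rV[R]_n.
Implicit Types (f : V -> \bar R) (x y u v : V).

Definition dom f : set V := [set x | (f x < +oo)%E].

Definition ext_convex f : Prop :=
  forall x y (t : R), 0 < t -> t < 1 ->
    (f (t *: x + (1 - t) *: y)%R <= t%:E * f x + (1 - t)%:E * f y)%E.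

(* [fine] replaces +oo by 0; differentiability at x therefore also asks that
   f be finite on a neighborhood of x. *)
Definition ext_differentiable_at f x : Prop :=
  (dom f)° x /\ differentiable (fine \o f) x.

Definition dot u v : R := \sum_(i < n) u ord0 i * v ord0 i.

Definition grad f x : V := \row_(i < n) 'D_(delta_mx ord0 i) (fine \o f) x.

Definition bregman f y x : \bar R :=
  (f y - f x - (dot (grad f x) (y - x)%R)%:E)%E.

(* Meaningful for x, y in X: rho = 1, u = y is then admissible, so that the
   infimum is that of a nonempty subset of the positive reals. *)
Definition radial (X : set V) y x : R :=
  inf [set rho : R | 0 < rho /\ exists2 u, X u & y - x = rho *: (u - x)].

Definition half_sq_radial (X : set V) y x : R := radial X y x ^+ 2 / 2.

Definition min_value f (X : set V) : \bar R := ereal_inf [set f x | x in X].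

Definition solution_set f (X : set V) : set V :=
  [set x | X x /\ f x = min_value f X].

(* Infimum over a possibly empty set: the constant is +oo if no L works. The
   two suprema below are over sets of reals and may equal +oo; xbar is the map
   selecting the closest solution. *)
Definition smoothness_const f (X : set V) (dist : V -> V -> R) : \bar R :=
  ereal_inf [set L%:E | L in [set L : R | 0 < L /\
    forall x y, X x -> X y -> (bregman f y x <= (L * dist y x)%:E)%E]].

Definition quasi_strong_convexity_const f (X : set V) (dist : V -> V -> R)
    (xbar : V -> V) : \bar R :=
  ereal_sup [set m%:E | m in [set m : R | 0 <= m /\
    forall x, X x ->
      ((m * dist (xbar x) x)%:E <= bregman f (xbar x) x)%E]].

Definition functional_growth_const f (X : set V) (dist : V -> V -> R)
    (xbar : V -> V) : \bar R :=
  ereal_sup [set m%:E | m in [set m : R | 0 <= m /\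
    forall x, X x ->
      ((m * dist (xbar x) x)%:E <= f x - min_value f X)%E]].

End ExtendedFunctions.

(* Main.v *)
(* Write g = f - f*, r = r(xbar, x) and G = <grad f(x), x - u> for the linear
   oracle u at x. Since xbar - x = rho (v - x) with v in X and rho arbitrarily
   close to r, <grad f(x), x - xbar> <= r G. Relative smoothness gives
   g(x') <= g(x) - a G + L a^2 / 2 for every a in [0, 1], and one takes
   a = mu r / L under quasi-strong convexity, a = mu r / (2 L) under functional
   growth. The first choice is admissible because mu <= L follows by comparing
   both bounds on D_f(xbar, x). The second one needs the functional growth
   constant to be at most 2 L: near the solution set r is small, the segment from
   x to xbar can be prolonged well beyond xbar inside X, and there smoothness and
   convexity yield g(x) <= c L r^2 with c < 1. If some gap is positive this also
   shows 0 < mu <= L < +oo; otherwise both sides of the claim vanish. *)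
Require Import Defs.
From HB Require Import structures.
From mathcomp Require Import all_boot all_order all_algebra.
From mathcomp Require Import interval_inference.
From mathcomp Require Import all_classical all_reals all_analysis.
From mathcomp Require Import ring lra.

Import Order.TTheory GRing.Theory Num.Theory.
Import numFieldNormedType.Exports.

Local Open Scope classical_set_scope.
Local Open Scope ring_scope.

(** * One step of the method *)

Section StepSize.
Context {R : realType}.

(** At [a = m r / L] the quadratic model drops by exactly [m / L] times [r G - m r ^+ 2 / 2], a
    quantity that is at least [g]. *)
Lemma stepsize_decrease (g g' G r m L : R) : 0 < L -> 0 <= m -> m <= L ->
  0 <= r <= 1 -> g <= r * G - m * r ^+ 2 / 2 ->
  (forall a, 0 <= a <= 1 -> g' <= g - a * G + L * a ^+ 2 / 2) ->
  m * g <= L * (g - g').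
Proof.
move=> L0 m0 mL /andP[r0 r1] gG /(_ (m * r / L)) step.
have mr : 0 <= m * r <= L.
  by rewrite mulr_ge0//= (le_trans _ mL)// ler_piMr.
have /step : 0 <= m * r / L <= 1.
  by case/andP: mr => mr0 mrL; rewrite divr_ge0 ?ler_pdivrMr ?mul1r// ltW.
have -> : g - m * r / L * G + L * (m * r / L) ^+ 2 / 2 =
    g - (m * (r * G - m * r ^+ 2 / 2)) / L.
  by field; rewrite gt_eqF.
rewrite lerBrDl -lerBrDr ler_pdivrMr// [_ * L]mulrC.
by apply: le_trans; rewrite ler_wpM2l.
Qed.

Lemma stepsize_decrease_growth (g g' G r m L : R) :
  0 < L -> 0 <= m -> m <= 2 * L -> 0 <= r <= 1 -> g <= r * G ->
  m * (r ^+ 2 / 2) <= g ->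
  (forall a, 0 <= a <= 1 -> g' <= g - a * G + L * a ^+ 2 / 2) ->
  m / 4 * g <= L * (g - g').
Proof.
move=> L0 m0 mL r01 gG gm step.
(* [g = h + m r^2 / 4 <= 2 h], so [stepsize_decrease] for [h] and [m / 2] loses
   at most a further factor 2. *)
set h := g - m / 2 * r ^+ 2 / 2.
have -> : g - g' = h - (g' - g + h) by ring.
have hg : g / 2 <= h by rewrite /h; lra.
apply: (@le_trans _ _ (m / 2 * h)).
  by rewrite (_ : m / 4 * g = m / 2 * (g / 2)) ?ler_wpM2l ?divr_ge0//; field.
apply: (stepsize_decrease _ _ G r) => //; try by rewrite /h; lra.
by move=> a /step; lra.
Qed.

End StepSize.

(** * Relative growth against relative smoothness *)

Section Descent.
Context {R : realType} {V : lmodType R} (X : set V) (phi : V -> R)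
  (dphi : V -> V -> R) (L : R).
Hypothesis X_segment : forall x u (t : R), X x -> X u -> 0 <= t <= 1 ->
  X (x + t *: (u - x)).
Hypothesis dphiZ : forall x a v, dphi x (a *: v) = a * dphi x v.
Hypothesis subgradient : forall x y, X x -> X y ->
  phi x + dphi x (y - x) <= phi y.
Hypothesis smooth : forall x u (a : R), X x -> X u -> 0 <= a <= 1 ->
  phi (x + a *: (u - x)) <= phi x + a * dphi x (u - x) + L * a ^+ 2 / 2.
Hypothesis phi_ge0 : forall x, X x -> 0 <= phi x.

(* The slope at [x + t (u - x)] in the direction [u - x] is bounded above by the
   subgradient inequality towards [t'], and below by smoothness at [t + c], where
   [phi >= 0]. *)
Lemma segment_descent x u (t t' c : R) : X x -> X u ->
  0 <= t -> t <= t' -> t' <= 1 -> t < 1 -> 0 < c -> t + c <= 1 ->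
  phi (x + t *: (u - x)) * (1 - (t' - t) / c) <=
  phi (x + t' *: (u - x)) + (t' - t) * c * (L / (1 - t) ^+ 2) / 2.
Proof.
move=> Xx Xu t0 tt' t'1 t1 c0 tc1.
set p := x + t *: (u - x).
have Xp : X p by apply: X_segment => //; lra.
have pE s : x + s *: (u - x) = p + (s - t) *: (u - x).
  by rewrite /p -addrA -scalerDl subrKC.
have upE : u - p = (1 - t) *: (u - x).
  by rewrite /p opprD addrA scalerBl scale1r.
set e := dphi p (u - x).
have lo : phi p + (t' - t) * e <= phi (x + t' *: (u - x)).
  have Xq : X (x + t' *: (u - x)) by apply: X_segment => //; lra.
  have := subgradient _ _ Xp Xq.
  by rewrite [in dphi _ _]pE addrAC subrr add0r dphiZ.
have hi : 0 <= phi p + c * e + c ^+ 2 * (L / (1 - t) ^+ 2) / 2.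
  (* Moving from [p] by [c *: (u - x)] covers the fraction [c / (1 - t)] of [u - p]; hence the
     factor [1 / (1 - t) ^+ 2]. *)
  have a01 : 0 <= c / (1 - t) <= 1.
    by apply/andP; split; [apply: divr_ge0; lra | rewrite ler_pdivrMr; lra].
  have := smooth _ _ _ Xp Xu a01.
  have /= := phi_ge0 _ (X_segment _ _ _ Xp Xu a01).
  move=> /le_trans/[apply]; rewrite upE dphiZ -/e.
  suff -> : phi p + c / (1 - t) * ((1 - t) * e) + L * (c / (1 - t)) ^+ 2 / 2 =
    phi p + c * e + c ^+ 2 * (L / (1 - t) ^+ 2) / 2 by [].
  by field; rewrite gt_eqF// subr_gt0.
(* After this scaling, [hi] has the same slope term [(t' - t) * e] as [lo], so [e] can be
   eliminated. *)
have : 0 <= (t' - t) / c * (phi p + c * e + c ^+ 2 * (L / (1 - t) ^+ 2) / 2).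
  by rewrite mulr_ge0// divr_ge0 ?subr_ge0 // ltW.
have -> : (t' - t) / c * (phi p + c * e + c ^+ 2 * (L / (1 - t) ^+ 2) / 2) =
  phi p * ((t' - t) / c) + (t' - t) * e + (t' - t) * c * (L / (1 - t) ^+ 2) / 2.
  by field; rewrite !gt_eqF ?subr_gt0.
lra.
Qed.

(* A single application of [segment_descent] only gives the constant 2, which is
   too weak: [growth_le_smoothness] needs a constant at most 1. Going from [x] to
   [y] through the points at 1/2, 3/4 and 7/8 of the way brings it down to 0.96,
   and [rho <= 1/200] controls the factor [1 / (1 - t)^2]. *)
Lemma quadratic_upper_bound x y u rho : 0 <= L -> X x -> X u ->
  phi y = 0 -> 0 < rho <= 200^-1 -> y - x = rho *: (u - x) ->
  phi x <= 98 / 100 * L * rho ^+ 2.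
Proof.
move=> L0 Xx Xu y0 /andP[r0 r1] yx.
have yE : y = x + rho *: (u - x) by rewrite -yx subrKC.
have K t : 0 <= t -> t <= 200^-1 -> L / (1 - t) ^+ 2 <= 101 / 99 * L.
  move=> t0 t1; rewrite ler_pdivrMr; last by apply: exprn_gt0; lra.
  rewrite [leRHS]mulrC mulrA ler_peMl//; nra.
pose g t := phi (x + t *: (u - x)).
(* Parameters are now in units of [rho]: 0 is [x] and 1 is [y]. The condition [a + c <= 100] keeps
   the prolonged point at most halfway to [u]. *)
have bnd a b c : 0 <= a -> a < b -> b <= 1 -> 0 < c -> a + c <= 100 ->
    g (a * rho) * (1 - (b - a) / c) <=
    g (b * rho) + (b - a) * c * (101 / 99 * L * rho ^+ 2) / 2.
  move=> a0 ab b1 c0 ac.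
  have -> : (b - a) / c = (b * rho - a * rho) / (c * rho).
    by field; rewrite !gt_eqF.
  have ar0 : 0 <= a * rho by rewrite mulr_ge0// ltW.
  have abr : a * rho < b * rho by rewrite ltr_pM2r.
  have br : b * rho <= rho by rewrite ler_piMl// ltW.
  have cr0 : 0 < c * rho by rewrite mulr_gt0.
  have acr : (a + c) * rho <= 100 * 200^-1 by apply: ler_pM => //; lra.
  apply: (le_trans (segment_descent x u _ _ _ Xx Xu _ _ _ _ cr0 _)); try lra.
  rewrite lerD2l ler_pM2r ?invr_gt0//.
  have -> : (b - a) * c * (101 / 99 * L * rho ^+ 2) =
      (b * rho - a * rho) * (c * rho) * (101 / 99 * L) by ring.
  rewrite ler_wpM2l//; first by apply: mulr_ge0; lra.
  by apply: K; lra.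
have g1 : g (1 * rho) = 0 by rewrite mul1r /g -yE.
have g0 : g (0 * rho) = phi x by rewrite mul0r /g scale0r addr0.
have Lr : 0 <= L * rho ^+ 2 by rewrite mulr_ge0// sqr_ge0.
(* With [C = 101 / 99 * L * rho ^+ 2], the four bounds give in turn [C / 32], [C / 12], [4 C / 15]
   and [24 C / 25] at 7/8, 3/4, 1/2 and 0; finally [24 / 25 * 101 / 99 < 98 / 100]. *)
have b3 := bnd (7 / 8) 1 (4^-1)
  ltac:(lra) ltac:(lra) ltac:(lra) ltac:(lra) ltac:(lra).
have b2 := bnd (3 / 4) (7 / 8) (3^-1)
  ltac:(lra) ltac:(lra) ltac:(lra) ltac:(lra) ltac:(lra).
have b1 := bnd (2^-1) (3 / 4) (2 / 3)
  ltac:(lra) ltac:(lra) ltac:(lra) ltac:(lra) ltac:(lra).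
have b0 := bnd 0 (2^-1) (4 / 3)
  ltac:(lra) ltac:(lra) ltac:(lra) ltac:(lra) ltac:(lra).
rewrite g1 in b3; rewrite g0 in b0.
lra.
Qed.

Lemma midpoint_le x y : X x -> X y ->
  phi (y + 2^-1 *: (x - y)) <= (phi x + phi y) / 2.
Proof.
move=> Xx Xy; set w := y + _.
have Xw : X w by apply: X_segment => //; lra.
have yw : y - w = - 2^-1 *: (x - y) by rewrite /w opprD addrA subrr add0r scaleNr.
have xw : x - w = 2^-1 *: (x - y).
  by rewrite /w opprD addrA -{1}[x - y]scale1r -scalerBl; congr (_ *: _); lra.
have := subgradient _ _ Xw Xy; have := subgradient _ _ Xw Xx.
rewrite yw xw !dphiZ; lra.
Qed.

(* Otherwise all the points [y + 2^-n (z - y)] would be zeros of [phi], against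
   the subgradient inequality at [y]. *)
Lemma positive_halving z y : X z -> phi z = 0 -> X y -> 0 < phi y ->
  exists w, [/\ X w, 0 < phi w & phi w <= phi y / 2].
Proof.
move=> Xz z0 Xy y0; apply: contrapT => noHalf.
have zero n : let w := y + 2^-1 ^+ n *: (z - y) in X w /\ phi w = 0.
  elim: n => [|n [Xw w0]] /=; first by rewrite expr0 scale1r subrKC.
  set w := y + _ in Xw w0.
  have wE : y + 2^-1 ^+ n.+1 *: (z - y) = y + 2^-1 *: (w - y).
    by rewrite /w [y + _ - y]addrAC subrr add0r scalerA exprS.
  have Xw' : X (y + 2^-1 *: (w - y)) by apply: X_segment => //; lra.
  rewrite wE; split=> //; apply/eqP; rewrite eq_le phi_ge0// andbT leNgt.
  apply/negP => w'0; apply: noHalf; exists (y + 2^-1 *: (w - y)); split=> //.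
  by have := midpoint_le _ _ Xw Xy; rewrite w0 add0r.
set d := dphi y (z - y).
(* Choosing [n] with [2^-n (|d| + 1) < phi y] keeps the lower bound [phi y + 2^-n d] positive at a
   supposed zero of [phi]. *)
have d0 : 0 < `|d| + 1 by rewrite ltr_wpDl.
have [n] := near_infty_natSinv_expn_lt (PosNum (divr_gt0 y0 d0)).
move=> _ /(_ n (leqnn n)) /=; rewrite ltr_pdivlMr// div1r -exprVn.
have [Xw w0] := zero n.
have := subgradient _ _ Xy Xw; rewrite w0 [_ - y]addrAC subrr add0r dphiZ -/d.
set c := 2^-1 ^+ n => sub.
have c0 : 0 < c by rewrite exprn_gt0.
have : c * - d <= c * `|d| by rewrite ler_pM2l// -normrN ler_norm.
lra.
Qed.

(** Iterated halving; at the points it yields, relative growth forces a small radial distance. *)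
Lemma positive_small z y (eps : R) : X z -> phi z = 0 -> X y -> 0 < phi y ->
  0 < eps -> exists w, [/\ X w, 0 < phi w & phi w <= eps].
Proof.
move=> Xz z0 Xy y0 eps0.
have iter_half n : exists w, [/\ X w, 0 < phi w & phi w <= phi y / 2 ^+ n].
  elim: n => [|n [w [Xw w0 wn]]]; first by exists y; rewrite expr0 divr1.
  have [w' [Xw' w'0 w'n]] := positive_halving _ _ Xz z0 Xw w0.
  exists w'; split=> //; apply: (le_trans w'n).
  by rewrite exprSr invfM mulrA ler_pM2r ?invr_gt0.
have [n] := near_infty_natSinv_expn_lt (PosNum (divr_gt0 eps0 y0)).
move=> _ /(_ n (leqnn n)) /=; rewrite ltr_pdivlMr// => /ltW small.
have [w [Xw w0 wn]] := iter_half n; exists w; split=> //.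
by rewrite (le_trans wn)// mulrC -div1r.
Qed.

(* [r x] stands for the radial distance from [x] to its closest zero of [phi]; at
   points where [phi] is small and positive, [r] is small, so that
   [quadratic_upper_bound] applies. *)
Lemma growth_le_smoothness (r : V -> R) (m : R) z y : 0 <= L ->
  (forall x, 0 <= r x) ->
  (forall x e, X x -> 0 < e -> exists rho u x',
    [/\ X u, phi x' = 0, 0 < rho, rho < r x + e & x' - x = rho *: (u - x)]) ->
  (forall x, X x -> m * (r x ^+ 2 / 2) <= phi x) ->
  X z -> phi z = 0 -> X y -> 0 < phi y -> m <= 2 * L.
Proof.
move=> L0 r0 r_approx growth Xz z0 Xy y0; rewrite leNgt; apply/negP => Lm.
have m0 : 0 < m by lra.
(* With [r x <= d] and [e <= d], the approximate radius [rho < r x + e] stays below [200^-1]. *)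
have [d d0 dE] : exists2 d : R, 0 < d & d = 400^-1.
  by exists (400^-1); rewrite ?invr_gt0 ?ltr0n.
(* The threshold is the one that growth turns into [r x <= d]. *)
have [|x [Xx x0 xs]] := positive_small _ _ (m / 2 * d ^+ 2) Xz z0 Xy y0.
  by rewrite mulr_gt0 ?exprn_gt0 ?divr_gt0.
have rx : r x <= d.
  rewrite -(@ler_pXn2r _ 2) ?nnegrE ?r0 ?(ltW d0)//.
  rewrite -(ler_pM2l (divr_gt0 m0 (ltr0n _ 2))).
  by rewrite (le_trans _ xs)// (le_trans _ (growth _ Xx))// mulrAC -mulrA.
have bound e : 0 < e -> e <= d ->
    phi x <= 98 / 100 * L * r x ^+ 2 + 3 * L * e.
  move=> e0 e1.
  have [rho [u [x' [Xu x'0 rho0 rho_lt x'E]]]] := r_approx _ _ Xx e0.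
  have rho01 : 0 < rho <= 200^-1 by rewrite rho0/=; lra.
  apply: (le_trans (quadratic_upper_bound _ _ _ _ L0 Xx Xu x'0 rho01 x'E)).
  have : rho ^+ 2 <= r x ^+ 2 + 3 * e by have := r0 x; nra.
  by move=> /(ler_wpM2l L0); nra.
(* This lets [e] tend to 0; the divisor [3 * L + 1] is positive even when [L = 0]. *)
have : phi x <= 98 / 100 * L * r x ^+ 2.
  rewrite leNgt; apply/negP => gap.
  set c := phi x - 98 / 100 * L * r x ^+ 2.
  have c0 : 0 < c by rewrite subr_gt0.
  have D0 : 0 < 3 * L + 1 by lra.
  have e0 : 0 < Num.min d (c / (3 * L + 1)).
    by rewrite lt_min d0 divr_gt0.
  have := bound _ e0; rewrite ge_min lexx/= => /(_ isT).
  have : 3 * L * Num.min d (c / (3 * L + 1)) <= 3 * L * (c / (3 * L + 1)).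
    by rewrite ler_wpM2l// ?ge_min ?lexx ?orbT// mulr_ge0.
  have : 3 * L * (c / (3 * L + 1)) < c.
    by rewrite mulrA ltr_pdivrMr// mulrC ltr_pM2l//; lra.
  rewrite /c; lra.
(* Now [L r^2 <= m / 2 r^2 <= phi x <= 98 / 100 L r^2] forces [phi x <= 0]. *)
have := growth _ Xx.
have : L * r x ^+ 2 <= m / 2 * r x ^+ 2 by rewrite ler_wpM2r ?sqr_ge0//; lra.
have : 0 <= L * r x ^+ 2 by rewrite mulr_ge0 ?sqr_ge0.
lra.
Qed.

End Descent.

(** * Radial distance and gradients *)

Section Radial.
Context {R : realType} {n : nat} (X : set 'rV[R]_n).

Lemma radial_le y x u rho : 0 < rho -> X u -> y - x = rho *: (u - x) ->
  radial X y x <= rho.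
Proof.
move=> rho0 Xu yx; apply: ge_inf; last by split=> //; exists u.
by exists 0 => r [/ltW].
Qed.

Lemma radial_ge0 y x : 0 <= radial X y x.
Proof.
rewrite /radial; set A := [set _ | _].
have [->|/set0P A0] := eqVneq A set0; first by rewrite inf0.
by apply: lb_le_inf => // r [/ltW].
Qed.

Lemma radial_le1 y x : X y -> radial X y x <= 1.
Proof. by move=> Xy; apply: (@radial_le y x y) => //; rewrite scale1r. Qed.

Lemma radial_approx y x e : X y -> 0 < e ->
  exists rho u, [/\ X u, 0 < rho, rho < radial X y x + e & y - x = rho *: (u - x)].
Proof.
move=> Xy e0; rewrite /radial; set A := [set _ | _].
have /(inf_adherent e0) : has_inf A.
  split; last by exists 0 => r [/ltW].
  by exists 1; split=> //; exists y => //; rewrite scale1r.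
by move=> [rho [rho0 [u Xu yx]] rho_lt]; exists rho, u.
Qed.

(** Every admissible [rho] satisfies [l (y - x) = rho * l (u - x) <= rho * G]. Dividing by [G] makes
    the left side a lower bound for the infimum, which need not be attained; [G = 0] is treated
    apart. *)
Lemma radial_linear_le (l : 'rV[R]_n -> R) (G : R) y x :
  (forall a v, l (a *: v) = a * l v) -> 0 <= G ->
  (forall u, X u -> l (u - x) <= G) -> X y ->
  l (y - x) <= radial X y x * G.
Proof.
move=> lZ; rewrite le0r => /predU1P[-> lG|G0 lG] Xy.
  have [rho [u [Xu rho0 _ ->]]] := radial_approx _ x _ Xy ltr01.
  by rewrite lZ mulr0 mulr_ge0_le0 ?lG// ltW.
rewrite -ler_pdivrMr//; apply: lb_le_inf.
  by exists 1; split=> //; exists y => //; rewrite scale1r.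
by move=> rho [rho0 [u Xu ->]]; rewrite lZ ler_pdivrMr// ler_pM2l// lG.
Qed.

End Radial.

Section Gradient.
Context {R : realType} {n : nat}.
Implicit Types (f : 'rV[R]_n -> \bar R) (u v x y : 'rV[R]_n).

Lemma dotZ u a v : dot u (a *: v) = a * dot u v.
Proof. by rewrite /dot mulr_sumr; apply: eq_bigr => i _; rewrite mxE mulrCA. Qed.

Lemma dotB u v w : dot u (v - w) = dot u v - dot u w.
Proof.
by rewrite /dot -sumrB; apply: eq_bigr => i _; rewrite !mxE mulrBr.
Qed.

Lemma derive_dot f x v : differentiable (fine \o f) x ->
  'D_v (fine \o f) x = dot (grad f x) v.
Proof.
move=> df; rewrite deriveE// {1}[v]row_sum_delta linear_sum.
by apply: eq_bigr => i _; rewrite linearZ/= mxE deriveE// mulrC.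
Qed.

(** By convexity the difference quotients at [x] with step [h] in [(0, 1)] are at most [f y - f x];
    the right limit is the directional derivative. *)
Lemma convex_subgradient f x y : ext_convex f ->
  f x \is a fin_num -> f y \is a fin_num ->
  (forall z, (-oo < f z)%E) ->
  differentiable (fine \o f) x ->
  fine (f x) + dot (grad f x) (y - x) <= fine (f y).
Proof.
move=> cf fx fy fNoo df; rewrite -lerBrDl -derive_dot//.
have dx : derivable (fine \o f) x (y - x) by exact: diff_derivable.
rewrite /derive cvg_at_rightE//.
apply: limr_le; first by apply: cvgP; exact: cvg_dnbhs_at_right dx.
near=> h.
have h0 : 0 < h by near: h; exact: nbhs_right_gt.
have h1 : h < 1 by near: h; exact: nbhs_right_lt.
rewrite /= -[_ *: _]/(_ * _) mulrC ler_pdivrMr//.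
have := cf y x h h0 h1.
have -> : h *: y + (1 - h) *: x = h *: (y - x) + x.
  by rewrite scalerBl scale1r scalerBr addrA addrAC.
have := fNoo (h *: (y - x) + x).
rewrite -(fineK fx) -(fineK fy) -!EFinM -EFinD /=.
(* Convexity between finite values excludes [+oo] here, so [fine] is faithful. *)
case: (f (h *: _ + x)) => //= r _; rewrite lee_fin; lra.
Unshelve. all: by end_near. Qed.

End Gradient.

(** * Frank-Wolfe *)

Definition gap {R : realType} {n : nat} (f : 'rV[R]_n -> \bar R)
    (X : set 'rV[R]_n) z : R := fine (f z) - fine (min_value f X).

Section FrankWolfe.
Context {R : realType} {n : nat} (f : 'rV[R]_n -> \bar R) (X : set 'rV[R]_n)
  (xbar : 'rV[R]_n -> 'rV[R]_n) (L : R).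
Hypothesis f_gt_ninfty : forall z, (-oo < f z)%E.
Hypothesis f_convex : ext_convex f.
Hypothesis f_differentiable : forall z, dom f z -> ext_differentiable_at f z.
Hypothesis X_dom : X `<=` dom f.
Hypothesis X_convex : @convex_set R 'rV[R]_n X.
Hypothesis fstar_finite : min_value f X \is a fin_num.
Hypothesis xbar_sol : forall z, X z -> solution_set f X (xbar z).
Hypothesis L_def : smoothness_const f X (half_sq_radial X) = L%:E.

Local Notation phi := (gap f X).
Local Notation r z := (radial X (xbar z) z).

Lemma fin_num_on x : X x -> f x \is a fin_num.
Proof. by move=> /X_dom fx; rewrite fin_real// f_gt_ninfty fx. Qed.

Lemma gapE x : X x -> (f x - min_value f X)%E = (phi x)%:E.
Proof.
by move=> /fin_num_on fx; rewrite -(fineK fx) -(fineK fstar_finite).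
Qed.

Lemma gap_ge0 x : X x -> 0 <= phi x.
Proof.
move=> Xx; rewrite -lee_fin -gapE// sube_ge0 ?fstar_finite ?orbT//.
by apply: ereal_inf_lbound; exists x.
Qed.

Lemma gap_solution x : solution_set f X x -> phi x = 0.
Proof. by case=> _ fx; rewrite /gap fx subrr. Qed.

Lemma convex_segment x u (t : R) : X x -> X u -> 0 <= t <= 1 ->
  X (x + t *: (u - x)).
Proof.
move=> /mem_set Xx /mem_set Xu /andP[t0 t1].
have := @X_convex u x (Itv01 t0 t1) Xu Xx; rewrite inE.
by congr X; rewrite /conv/= /unstable.onem scalerBl scale1r scalerBr addrCA.
Qed.

Lemma gap_subgradient x y : X x -> X y ->
  phi x + dot (grad f x) (y - x) <= phi y.
Proof.
move=> Xx Xy; rewrite /gap addrAC lerD2r.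
apply: convex_subgradient => //; try exact: fin_num_on.
by case: (f_differentiable _ (X_dom _ Xx)).
Qed.

Lemma bregmanE x y : X x -> X y ->
  bregman f y x = (phi y - phi x - dot (grad f x) (y - x))%:E.
Proof.
move=> Xx Xy; rewrite /bregman.
rewrite -(fineK (fin_num_on _ Xx)) -(fineK (fin_num_on _ Xy)).
by rewrite -!EFinB /gap; congr (_%:E); ring.
Qed.

Lemma smoothness_ge0 : 0 <= L.
Proof.
rewrite -lee_fin -L_def; apply: le_ereal_inf_tmp => _ [l [l0 _] <-].
by rewrite lee_fin ltW.
Qed.

(** At positive distance, dividing by it passes the bound to the infimum. At distance zero all
    admissible constants give the same bound, and one exists since the infimum is finite. *)
Lemma smoothness_attained x y : X x -> X y ->
  phi y - phi x - dot (grad f x) (y - x) <= L * half_sq_radial X y x.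
Proof.
move=> Xx Xy; set D := _ - _.
have lP l : (0 < l /\ forall x y, X x -> X y ->
    (bregman f y x <= (l * half_sq_radial X y x)%:E)%E) ->
    D <= l * half_sq_radial X y x.
  by move=> [_ /(_ _ _ Xx Xy)]; rewrite bregmanE// lee_fin.
have : 0 <= half_sq_radial X y x by rewrite divr_ge0 ?sqr_ge0.
rewrite le0r => /predU1P[h0|h0]; last first.
  rewrite -ler_pdivrMr// -lee_fin -L_def; apply: le_ereal_inf_tmp => _ [l Sl <-].
  by rewrite lee_fin ler_pdivrMr// lP.
have : exists l, 0 < l /\ forall x y, X x -> X y ->
    (bregman f y x <= (l * half_sq_radial X y x)%:E)%E.
  apply: contrapT => nol; move: L_def; rewrite /smoothness_const.
  rewrite (_ : [set _ | _ in _] = set0) ?ereal_inf0//.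
  by rewrite -subset0 => e [l Sl _]; apply: nol; exists l.
by move=> [l Sl]; have := lP _ Sl; rewrite h0 !mulr0.
Qed.

(** The point reached is within radial distance [a] of [x], with [u] as witness; [a = 0] is separate
    because witnesses need [rho > 0]. *)
Lemma smoothness_segment x u (a : R) : X x -> X u -> 0 <= a <= 1 ->
  phi (x + a *: (u - x)) <=
  phi x + a * dot (grad f x) (u - x) + L * a ^+ 2 / 2.
Proof.
move=> Xx Xu a01; have Xy := convex_segment _ _ _ Xx Xu a01.
have yx : x + a *: (u - x) - x = a *: (u - x) by rewrite addrAC subrr add0r.
have := smoothness_attained _ _ Xx Xy; rewrite yx dotZ.
case/andP: a01; rewrite le0r => /predU1P[-> _ _|a0 _].
  by rewrite scale0r addr0 mul0r expr0n/= mulr0 mul0r !addr0.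
have : radial X (x + a *: (u - x)) x ^+ 2 <= a ^+ 2.
  by rewrite ler_pXn2r ?nnegrE ?radial_ge0 ?(ltW a0)//; apply: radial_le yx.
move=> /(ler_wpM2l smoothness_ge0); rewrite /half_sq_radial.
lra.
Qed.

Lemma gap_le_radial x (G : R) : X x -> 0 <= G ->
  (forall u, X u -> - dot (grad f x) (u - x) <= G) ->
  - dot (grad f x) (xbar x - x) <= r x * G.
Proof.
move=> Xx G0 lG; have [Xb _] := xbar_sol _ Xx.
apply: (radial_linear_le _ (fun v => - dot (grad f x) v)) => // a v.
by rewrite dotZ mulrN.
Qed.

Lemma growth_const_bound y m : X y -> 0 < phi y ->
  (forall x, X x -> m * (r x ^+ 2 / 2) <= phi x) -> m <= 2 * L.
Proof.
move=> Xy y0 growth; have [Xb _] := xbar_sol _ Xy.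
apply: (growth_le_smoothness X phi (fun x => dot (grad f x)) L
  convex_segment _ gap_subgradient smoothness_segment gap_ge0 (fun z => r z) m
  (xbar y) y) => //; try exact: smoothness_ge0.
- by move=> *; rewrite dotZ.
- by move=> x; exact: radial_ge0.
- move=> x e Xx e0; have [Xbx _] := xbar_sol _ Xx.
  have [rho [u [Xu rho0 rhor ux]]] := radial_approx _ _ x _ Xbx e0.
  by exists rho, u, (xbar x); split=> //; exact/gap_solution/xbar_sol.
- exact/gap_solution/xbar_sol.
Qed.

(** * One iteration from a point of positive gap, with [phi'] for the next gap *)

Section Step.
Variables (x u : 'rV[R]_n) (phi' : R).
Hypotheses (Xx : X x) (u_oracle : argmin_set X (fun y => dot (grad f x) y) u).
Hypothesis gap_pos : 0 < phi x.
Hypothesis step : forall a : R, 0 <= a <= 1 ->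
  phi' <= phi x + a * dot (grad f x) (u - x) + L * a ^+ 2 / 2.

Let G := - dot (grad f x) (u - x).

Lemma step_le : phi' <= phi x.
Proof.
have /step : 0 <= (0 : R) <= 1 by rewrite lexx ler01.
by rewrite !mul0r expr0n/= mulr0 mul0r !addr0.
Qed.

Lemma slope_bound : - dot (grad f x) (xbar x - x) <= r x * G.
Proof.
have [Xu u_min] := u_oracle.
by apply: gap_le_radial => // [|v /u_min]; rewrite /G !dotB;
  have := u_min _ Xx; lra.
Qed.

Lemma gap_le_slope : phi x <= - dot (grad f x) (xbar x - x).
Proof.
have [Xb _] := xbar_sol _ Xx; have := gap_subgradient _ _ Xx Xb.
by rewrite (gap_solution (xbar x)); [lra | exact: xbar_sol].
Qed.

(** The gap is at most [r x * G], so a zero radius would make it nonpositive. *)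
Lemma radial_xbar_gt0 : 0 < r x.
Proof.
rewrite lt0r radial_ge0 andbT; apply: contraTneq gap_pos => r0.
by rewrite -leNgt (le_trans gap_le_slope)// (le_trans slope_bound)// r0 mul0r.
Qed.

Lemma radial_xbar_itv : 0 <= r x <= 1.
Proof. by rewrite radial_ge0 radial_le1//; case: (xbar_sol _ Xx). Qed.

Lemma quasi_const_step (m : R) : 0 <= m ->
  (forall z, X z ->
    ((m * half_sq_radial X (xbar z) z)%:E <= bregman f (xbar z) z)%E) ->
  m <= L /\ m * phi x <= L * (phi x - phi').
Proof.
move=> m0 /(_ _ Xx); have [Xb _] := xbar_sol _ Xx.
rewrite bregmanE// lee_fin (gap_solution (xbar x)); last exact: xbar_sol.
move=> quasi.
have mL : m <= L.
  rewrite -(@ler_pM2r _ (half_sq_radial X (xbar x) x)).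
    have := smoothness_attained _ _ Xx Xb.
    by rewrite (gap_solution (xbar x)); [apply: le_trans | exact: xbar_sol].
  by rewrite divr_gt0// exprn_gt0// radial_xbar_gt0.
split=> //.
(* Positivity of [L] comes only from [0 < m <= L]; for [m = 0] it suffices that the gap does not
   increase. *)
have [->|mneq0] := eqVneq m 0.
  by rewrite mul0r mulr_ge0 ?smoothness_ge0// subr_ge0 step_le.
have mgt0 : 0 < m by rewrite lt0r mneq0.
apply: (stepsize_decrease _ _ G (r x)) => //; rewrite ?radial_xbar_itv//.
- exact: lt_le_trans mL.
- by have := slope_bound; move: quasi; rewrite /half_sq_radial; lra.
- by move=> a /step; rewrite /G; lra.
Qed.

Lemma growth_const_step (m : R) : 0 <= m ->
  (forall z, X z ->
    ((m * half_sq_radial X (xbar z) z)%:E <= f z - min_value f X)%E) ->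
  m / 4 <= L /\ m / 4 * phi x <= L * (phi x - phi').
Proof.
move=> m0 growthE.
have growth z : X z -> m * (r z ^+ 2 / 2) <= phi z.
  by move=> Xz; rewrite -lee_fin -gapE//; exact: growthE.
have m2L := growth_const_bound _ _ Xx gap_pos growth.
have L0 := smoothness_ge0.
split; first by lra.
have [mz|mneq0] := eqVneq m 0.
  by rewrite mz !mul0r mulr_ge0// subr_ge0 step_le.
have mgt0 : 0 < m by rewrite lt0r mneq0.
apply: (stepsize_decrease_growth _ _ G (r x)) => //;
  rewrite ?radial_xbar_itv ?growth//; first by lra.
- exact: le_trans gap_le_slope slope_bound.
- by move=> a /step; rewrite /G; lra.
Qed.

(** Each admissible constant obeys two upper bounds, and these pass to the suprema and to their
    maximum, attained or not. The bound by [L] makes [mu] finite and [L] positive. *)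
Lemma geometric_step (mu : \bar R) :
  mu = maxe
     (quasi_strong_convexity_const f X (half_sq_radial X) xbar)
     (functional_growth_const f X (half_sq_radial X) xbar / 4%:E)%E ->
  (0 < mu)%E ->
  exists M, [/\ mu = M%:E, 0 < M <= L & M * phi x <= L * (phi x - phi')].
Proof.
move=> mu_def mu0.
have bound (c : R) :
    (forall m, 0 <= m -> m <= L /\ m * phi x <= L * (phi x - phi') -> m <= c) ->
    (mu <= c%:E)%E.
  move=> mc; rewrite mu_def ge_max; apply/andP; split.
    apply: ge_ereal_sup => _ [m [m0 mP] <-]; rewrite lee_fin.
    by apply: mc => //; exact: quasi_const_step.
  rewrite inver pnatr_eq0/= lee_pdivrMr//.
  apply: ge_ereal_sup => _ [m [m0 mP] <-]; rewrite -EFinM lee_fin -ler_pdivrMr//.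
  by apply: mc; [rewrite divr_ge0 | exact: growth_const_step].
have muL : (mu <= L%:E)%E by apply: bound => m _ [].
have muE : mu = (fine mu)%:E.
  by rewrite fineK// fin_numE; move: mu0 muL; case: (mu).
exists (fine mu); split=> //.
  by rewrite -lte_fin -lee_fin -muE mu0.
(* Dividing by [phi x > 0] turns the decrease into an upper bound on the constant. *)
rewrite -ler_pdivlMr// -lee_fin -muE; apply: bound => m _ [_].
by rewrite ler_pdivlMr.
Qed.

End Step.

End FrankWolfe.

Theorem proposition8 (R : realType) (n : nat)
  (f : 'rV[R]_n -> \bar R)
  (f_gt_ninfty : forall z, (-oo < f z)%E)
  (f_convex : ext_convex f)
  (f_differentiable : forall z, dom f z -> ext_differentiable_at f z)
  (X : set 'rV[R]_n)
  (X_dom : X `<=` dom f)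
  (X_compact : compact X)
  (X_convex : @convex_set R 'rV[R]_n X)
  (fstar_finite : min_value f X \is a fin_num)
  (Xstar_neq0 : solution_set f X !=set0)
  (xbar : 'rV[R]_n -> 'rV[R]_n)
  (xbar_argmin : forall z, X z ->
     argmin_set (solution_set f X) (fun y => radial X y z) = [set xbar z])
  (L : R)
  (L_def : smoothness_const f X (half_sq_radial X) = L%:E)
  (mu : \bar R)
  (mu_def : mu = maxe
     (quasi_strong_convexity_const f X (half_sq_radial X) xbar)
     (functional_growth_const f X (half_sq_radial X) xbar / 4%:E)%E)
  (mu_gt0 : (0 < mu)%E)
  (x u : nat -> 'rV[R]_n) (alpha : nat -> R)
  (x0_in : X (x 0%N))
  (u_oracle : forall k,
     argmin_set X (fun y => dot (grad f (x k)) y) (u k))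
  (x_step : forall k, x k.+1 = x k + alpha k *: (u k - x k))
  (alpha_argmin : forall k,
     argmin_set [set a : R | 0 <= a <= 1]
       (fun a => (f (x k) + (a * dot (grad f (x k)) (u k - x k)
                             + L * a ^+ 2 / 2)%:E)%E)
       (alpha k)) :
  forall k : nat,
    (f (x k) - min_value f X
       <= (1 - mu / L%:E) ^+ k * (f (x 0%N) - min_value f X))%E.
Proof.
have xbar_sol z : X z -> solution_set f X (xbar z).
  by move=> Xz; have [] : argmin_set (solution_set f X)
    (fun y => radial X y z) (xbar z) by rewrite xbar_argmin.
pose phi := gap f X.
have phiE z : X z -> (f z - min_value f X)%E = (phi z)%:E.
  exact: gapE.
have phi_ge0 z : X z -> 0 <= phi z by exact: gap_ge0.
have alpha01 k : 0 <= alpha k <= 1 by have [] := alpha_argmin k.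
have Xx k : X (x k).
  elim: k => // k Xk; rewrite x_step; apply: convex_segment => //.
  by have [] := u_oracle k.
(* Smoothness bounds the next gap by the model at [alpha k], which minimizes the model over
   [[0, 1]]. *)
have step k (a : R) : 0 <= a <= 1 -> phi (x k.+1) <=
    phi (x k) + a * dot (grad f (x k)) (u k - x k) + L * a ^+ 2 / 2.
  move=> a01; have [Xu _] := u_oracle k; have [_ /(_ a a01)] := alpha_argmin k.
  have fk := fin_num_on f X f_gt_ninfty X_dom _ (Xx k).
  rewrite -(fineK fk) -!EFinD lee_fin x_step lerD2l.
  have := smoothness_segment f X L f_gt_ninfty X_dom X_convex L_def
    _ _ _ (Xx k) Xu (alpha01 k).
  rewrite /phi /gap; lra.
have decr k : phi (x k.+1) <= phi (x k).
  exact: step_le (step k).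
move=> k; rewrite !phiE//.
(* With zero initial gap [mu / L] is not controlled, but the right side is a product with 0 and the
   gaps never increase. *)
have [x00|x0_neq] := eqVneq (phi (x 0%N)) 0.
  rewrite x00 mule0 lee_fin -x00.
  by elim: k => // k; apply: le_trans.
have x0_gt0 : 0 < phi (x 0%N) by rewrite lt0r x0_neq phi_ge0.
have key j : 0 < phi (x j) -> exists M, [/\ mu = M%:E, 0 < M <= L &
    M * phi (x j) <= L * (phi (x j) - phi (x j.+1))].
  move=> xj0; exact: (geometric_step f X xbar L f_gt_ninfty f_convex
    f_differentiable X_dom X_convex fstar_finite xbar_sol L_def
    (x j) (u j) _ (Xx j) (u_oracle j) xj0 (step j)).
have [M [muE /andP[M0 ML] _]] := key _ x0_gt0.
have L0 : 0 < L by exact: lt_le_trans ML.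
rewrite muE inver gt_eqF// -EFinM -EFinB -EFin_expe -EFinM lee_fin.
have q0 : 0 <= 1 - M / L by rewrite subr_ge0 ler_pdivrMr// mul1r.
elim: k => [|k IH]; first by rewrite expr0 mul1r.
(* The contraction is available only at positive gap; once the gap vanishes, monotonicity
   concludes. *)
have [xk0|xk_neq] := eqVneq (phi (x k)) 0.
  by rewrite (le_trans (decr k))// xk0 mulr_ge0 ?exprn_ge0// ltW.
have [|M' [+ _ stepM]] := key k; first by rewrite lt0r xk_neq phi_ge0.
rewrite muE => -[MM']; rewrite -{}MM' in stepM.
rewrite exprS -mulrA; apply: (le_trans _ (ler_wpM2l q0 IH)).
rewrite mulrBl mul1r mulrAC lerBrDr -lerBrDl ler_pdivrMr//.
by rewrite [_ * L]mulrC.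
Qed.
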